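(* Let $m>n$ be coprime positive integers with $m\not\equiv n \pmod 2$, and set $a=m^2-n^2$, $b=2mn$, $c=m^2+n^2$. If $$ m > \max\{10^{109948},\ n^{(\log n)^{3/2}}\}, $$ then the equation $a^x+b^y=c^z$ has no solution in positive integers $(x,y,z)\neq(2,2,2)$ with $x\equiv y\equiv z\equiv 0 \pmod 2$.
   Context: Here $\log$ denotes the natural logarithm. *)

(* Defs.v *)
From Stdlib Require Export ZArith Znumtheory Reals.

(* Real powers are written with [Rpower], which is the usual power only for a
   positive base.  In [Rpower (IZR n) (Rpower (ln (IZR n)) (3 / 2))] with
   [n >= 1] the inner base is positive except when [n = 1], where it is [0];
   there the value of the exponent is immaterial, since [Rpower 1 e = 1] for
   every [e]. *)

(* Main.v *)
(* Write [x = 2X], [y = 2Y], [z = 2Z].  The coprime factors [c^Z + b^Y] and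
   [c^Z - b^Y] of [a^(2X)] are [2X]-th powers [u^(2X)] and [v^(2X)] with
   [u v = a], and lifting the exponent at 2 in [u^(2X) - v^(2X) = 2 b^Y] gives
   [4^Y <= X (a + 1)]: all exponents are [O(log m)].  This settles [X > Z]
   (there [a^X > c^Z], as [a/c] is too close to 1), [X = Z] (modulo [b^4]) and
   [n = 1] (modulo [m^4]).  If [X < Z] and [n > 1], then [c^Z] and [b^Y] are
   nearly equal, so [K = 2Z - Y] satisfies [m^K < 2 (2n)^Y] and is [O(log n)];
   the condition [m > n^((log n)^(3/2))] makes [2^Z n^(K+1) < m].  Expanding
   [c^Z = (m^2 + n^2)^Z] by the binomial theorem and comparing quotients modulo
   [m^Y] with [b^Y = m^Y (2n)^Y] then shows that [n] divides [m^K], which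
   contradicts coprimality. *)

Require Import Defs.
From Stdlib Require Import ZArith Znumtheory Reals Lra.
From mathcomp Require Import all_boot zify.

(* MathComp rebinds the key [R]; the theorem below needs it for the real scope. *)
Delimit Scope R_scope with R.

Local Open Scope nat_scope.

(** * Coprime factors of a perfect power *)

Lemma gcdn_expn g h k : gcdn (g ^ k) (h ^ k) = gcdn g h ^ k.
Proof.
have [g0|g0] := posnP (gcdn g h).
  have /eqP := g0; rewrite eqn0Ngt gcdn_gt0 negb_or -!eqn0Ngt => /andP[/eqP-> /eqP->].
  by rewrite gcdnn.
have /dvdnP[g' eg] := dvdn_gcdl g h; have /dvdnP[h' eh] := dvdn_gcdr g h.
have [d ed] : exists d, gcdn g h = d by exists (gcdn g h).
rewrite ed in g0 eg eh *; subst g h.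
rewrite !expnMn -muln_gcdl -[RHS]mul1n.
move: ed; rewrite -muln_gcdl -[RHS]mul1n => e.
have co : coprime g' h' by rewrite /coprime -(eqn_pmul2r g0) e.
have /eqP -> // : coprime (g' ^ k) (h' ^ k) by rewrite coprimeXl ?coprimeXr.
Qed.

(** [gcd(p, r)^k = gcd(p^k, p q) = p gcd(p^(k-1), q) = p]. *)
Lemma coprime_mul_expn p q r k :
  0 < k -> coprime p q -> p * q = r ^ k -> p = gcdn p r ^ k.
Proof.
case: k => // k _ co e.
rewrite -gcdn_expn -e expnSr [p ^ k * p]mulnC -muln_gcdr.
have /eqP-> : coprime (p ^ k) q by rewrite coprimeXl.
by rewrite muln1.
Qed.

(** * Lifting the exponent at 2, and the resulting bound on [4 ^ Y] *)

Lemma odd_sum_odd k (F : 'I_k -> nat) :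
  (forall i, odd (F i)) -> odd (\sum_(i < k) F i) = odd k.
Proof.
elim: k F => [|k IH] F oF; first by rewrite big_ord0.
by rewrite big_ord_recr /= oddD IH // oF addbT.
Qed.

Lemma coprime_pow2_odd e s : odd s -> coprime (2 ^ e) s.
Proof. by move=> os; rewrite coprimeXl // coprime2n. Qed.

(** Strong induction on [X]. For odd [X] the cofactor of [U - V] is a sum of [X] odd terms, hence
    odd; for even [X] the factor [U ^ X./2 + V ^ X./2] is 2 modulo 4, so halving [X] costs exactly
    one factor 2. *)
Lemma pow2_dvdn_subX U V X e : U %% 4 = 1 -> V %% 4 = 1 -> 0 < X ->
  2 ^ e %| U ^ X - V ^ X -> 2 ^ e %| (U - V) * X.
Proof.
move=> U1 V1; have oU : odd U by lia.
have oV : odd V by lia.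
elim/ltn_ind: X e => X IH e X0.
have [oX|eX] := boolP (odd X).
  rewrite subn_exp Gauss_dvdl; first by move=> h; rewrite dvdn_mulr.
  apply: coprime_pow2_odd; rewrite odd_sum_odd // => i.
  by rewrite oddM !oddX oU oV !orbT.
case: e => [|e]; first by rewrite dvd1n.
have -> : X = X./2 * 2 by lia.
have h0 : 0 < X./2 by lia.
have modX W : W %% 4 = 1 -> W ^ X./2 %% 4 = 1 by move=> h; rewrite -modnXm h exp1n.
rewrite !expnM subn_sqr => d.
have {}d : 2 ^ e.+1 %| (U ^ X./2 - V ^ X./2) * 2.
  have := modX _ U1; have := modX _ V1; set S := (_ + _) in d => h1 h2.
  have [s es os] : exists2 s, S = 2 * s & odd s.
    by exists (S./2); rewrite /S; lia.
  by move: d; rewrite es mulnA Gauss_dvdl // coprime_pow2_odd.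
rewrite mulnA expnSr dvdn_pmul2r //.
by apply: IH => //; [lia | move: d; rewrite expnSr dvdn_pmul2r].
Qed.

(* [C + b^Y] and [C - b^Y] are coprime with product [a^(2X)], hence are themselves
   [2X]-th powers [u^(2X)], [v^(2X)] with [u v = a]; their difference [2 b^Y]
   is highly divisible by 2. *)
Lemma pow4_le a b C X Y : 0 < X -> odd a -> 4 %| b -> coprime a b -> 0 < b ->
  a ^ (2 * X) + (b ^ Y) ^ 2 = C ^ 2 -> 4 ^ Y <= X * (a + 1).
Proof.
move=> X0 oa b4 co b0 E.
have a0 : 0 < a by case: (a) oa.
set B := b ^ Y in E.
have B0 : 0 < B by rewrite expn_gt0 b0.
have BC : B < C by rewrite -ltn_sqr -E -[ltnLHS]add0n ltn_add2r expn_gt0 a0.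
have P : (C - B) * (C + B) = a ^ (2 * X) by rewrite -subn_sqr -E addnK.
have cop : coprime (C + B) (C - B).
  rewrite /coprime; set g := gcdn _ _.
  have g1 : g %| a ^ (2 * X) by rewrite -P dvdn_mull // dvdn_gcdl.
  have g2 : g %| 2 * B.
    have -> : 2 * B = (C + B) - (C - B) by lia.
    by rewrite dvdn_sub // (dvdn_gcdl, dvdn_gcdr).
  have : coprime (a ^ (2 * X)) (2 * B).
    by rewrite coprimeXl // coprimeMr coprimen2 oa coprimeXr.
  by move=> /eqP e1; rewrite -dvdn1 -e1 dvdn_gcd g1 g2.
have X20 : 0 < 2 * X by lia.
have eu := @coprime_mul_expn _ _ a _ X20 cop (etrans (mulnC _ _) P).
have ev := @coprime_mul_expn _ _ a _ X20 (etrans (coprime_sym _ _) cop) P.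
move: eu ev; set u := gcdn _ _; set v := gcdn _ _ => eu ev.
have uv : v * u = a.
  by apply: (@expIn (2 * X)) => //; rewrite expnMn -eu -ev.
have /andP[ov ou] : odd v && odd u by rewrite -oddM uv.
have v0 : 0 < v by case: (v) ov.
have u0 : 0 < u by case: (u) ou.
have ltvu : v < u by rewrite -(@ltn_exp2r _ _ (2 * X)) // -eu -ev; lia.
have sq w : odd w -> (w ^ 2) %% 4 = 1.
  move=> ow; have : w %% 4 = 1 \/ w %% 4 = 3 by lia.
  by rewrite -modnXm => -[] ->.
have D : 2 ^ (2 * Y).+1 %| (u ^ 2 - v ^ 2) * X.
  apply: pow2_dvdn_subX; rewrite ?sq // -!expnM -eu -ev.
  have -> : (C + B) - (C - B) = 2 * B by lia.
  by rewrite expnS dvdn_pmul2l // expnM dvdn_exp2r.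
rewrite -(expnM 2 2 Y).
have le_uv : u + v <= a + 1 by nia.
have fin w : 0 < w -> w <= a + 1 -> 2 ^ (2 * Y) %| w * X -> 2 ^ (2 * Y) <= X * (a + 1).
  move=> w0 wle dv; apply: leq_trans (dvdn_leq _ dv) _; first by rewrite muln_gt0 w0.
  by rewrite mulnC leq_mul2l wle orbT.
move: D; rewrite subn_sqr => D.
(* The even numbers [u + v] and [u - v] add up to [2u] with [u] odd, so one of them is twice an odd
   number. The other one, times [X], absorbs all of [4 ^ Y]. *)
have [o|o] : odd (u + v)./2 \/ odd (u - v)./2 by lia.
  apply: (@fin (u - v)); [lia|lia|].
  have es : u + v = 2 * (u + v)./2 by lia.
  move: D; rewrite es expnS.
  rewrite (_ : _ * _ * X = 2 * ((u - v) * X * (u + v)./2)); last by lia.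
  by rewrite dvdn_pmul2l // Gauss_dvdl // coprime_pow2_odd.
apply: (@fin (u + v)); [lia|lia|].
have es : u - v = 2 * (u - v)./2 by lia.
move: D; rewrite es expnS.
rewrite (_ : _ * _ * X = 2 * ((u + v) * X * (u - v)./2)); last by lia.
by rewrite dvdn_pmul2l // Gauss_dvdl // coprime_pow2_odd.
Qed.

(** * Binomial estimates and the cases [n = 1], [X = Z] and [X > Z] *)

(** Induction through [(a - (j+1)d)(a + d) <= a(a - jd)]; at [j = k] the factor [a - kd] is at least
    [a/2]. *)
Lemma expnD_le_double a d k : 0 < a -> 2 * k * d <= a -> (a + d) ^ k <= 2 * a ^ k.
Proof.
move=> a0 h.
have H j : (a - j * d) * (a + d) ^ j <= a ^ j.+1.
  elim: j => [|j IH]; first by rewrite mul0n subn0 expn0 muln1 expn1.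
  rewrite [(a + d) ^ _]expnS mulnA [a ^ j.+2]expnS.
  apply: (@leq_trans (a * ((a - j * d) * (a + d) ^ j))); last by rewrite leq_mul2l IH orbT.
  rewrite [leqRHS]mulnA leq_mul2r; apply/orP; right.
  have [hj|hj] := leqP (j.+1 * d) a; last by have -> : a - j.+1 * d = 0 by lia.
  move: hj; rewrite mulSn; move: (j * d) => t hj; nia.
rewrite -(@leq_pmul2l a) // mulnCA -expnS.
apply: leq_trans (_ : 2 * ((a - k * d) * (a + d) ^ k) <= _); last by rewrite leq_mul2l H orbT.
rewrite mulnA leq_mul2r; apply/orP; right; lia.
Qed.

Lemma expnD_second_order A B k :
  exists q, (A + B) ^ k = A ^ k + k * A ^ k.-1 * B + B ^ 2 * q.
Proof.
elim: k => [|k [q IH]]; first by exists 0; rewrite !expn0; lia.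
case: k IH => [|k] IH; first by exists 0; rewrite /= !expn1 expn0; lia.
exists (A * q + k.+1 * A ^ k + B * q).
rewrite expnS IH [A ^ k.+2]expnS /= [A ^ k.+1]expnS expnS expn1; nia.
Qed.

(** If [m <= 8Y], then [4^Y <= 4Y(8Y)^2 = 4^4 Y^3], against [Y^3 < 4^(Y-4)] for [Y >= 9]. The second
    bound cancels [4Y <= 2^Y], valid for [Y >= 4]. *)
Lemma pow4_le_polynomial m Y : 100 <= m -> 4 ^ Y <= 4 * Y * m ^ 2 -> 8 * Y < m /\ 2 ^ Y <= m ^ 2.
Proof.
move=> m1 h; split.
  rewrite ltnNge; apply/negP => hY.
  have Y9 : 9 <= Y by lia.
  have H k : (k + 9) ^ 3 < 4 ^ (k + 5).
    elim: k => [|k IH] //; rewrite !addSn [ltnRHS]expnS.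
    apply: (@leq_ltn_trans (4 * (k + 9) ^ 3)); last by rewrite ltn_mul2l IH.
    rewrite !expnS !expn0; nia.
  have := H (Y - 9); rewrite (_ : Y - 9 + 5 = Y - 4) ?subnK //; last by lia.
  rewrite -(@ltn_pmul2l (4 ^ 4)) // -expnD subnKC ?(leq_trans _ Y9) // ltnNge => /negP; apply.
  apply: leq_trans h _.
  apply: (@leq_trans (4 * Y * (8 * Y) ^ 2)); first by rewrite leq_mul2l leq_sqr hY orbT.
  by rewrite expnMn !expnS !expn0; lia.
have [Y4|Y4] := leqP 4 Y; last first.
  apply: (@leq_trans (2 ^ 3)); first by rewrite leq_exp2l //; lia.
  by rewrite !expnS !expn0; nia.
have H k : 4 * (k + 4) <= 2 ^ (k + 4).
  elim: k => [|k IH] //; rewrite addSn expnS; lia.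
have := H (Y - 4); rewrite subnK // => {}H.
have P : 0 < 2 ^ Y by rewrite expn_gt0.
rewrite -(@leq_pmul2l (2 ^ Y)) // -expnMn; apply: leq_trans h _.
by rewrite leq_mul2r H orbT.
Qed.

(** Modulo [m^4] the power of [2m] vanishes because [Y >= 2], and the equation becomes
    [1 - 2X m^2 = 1 + 2Z m^2]; so [m^2] divides [2(X + Z)]. *)
Lemma sqr_leq_exponents_n1 m X Y Z : 1 < m -> 0 < X -> 1 < Y ->
  (m ^ 2 - 1) ^ (2 * X) + (2 * m) ^ (2 * Y) = (m ^ 2 + 1) ^ (2 * Z) ->
  m ^ 2 <= 2 * (X + Z).
Proof.
move=> m1 X0 Y1 E.
apply: dvdn_leq; first by lia.
have sq x y : x = y -> x %% m ^ 2 = y %% m ^ 2 by move->.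
have m2 : 3 < m ^ 2 by rewrite expnS expn1; nia.
have ea : (m ^ 2 - 1) ^ 2 = 1 + m ^ 2 * (m ^ 2 - 2).
  by move: (m ^ 2) m2 => M M3; rewrite expnS expn1; nia.
have ec : (m ^ 2 + 1) ^ 2 = 1 + m ^ 2 * (m ^ 2 + 2).
  by move: (m ^ 2) m2 => M M3; rewrite expnS expn1; nia.
have eb : (2 * m) ^ (2 * Y) = m ^ 2 * (m ^ 2 * (16 * (2 * m) ^ (2 * Y - 4))).
  have -> : 2 * Y = 4 + (2 * Y - 4) by lia.
  rewrite [LHS]expnD addKn [(2 * m) ^ 4]expnMn !expnS !expn0; lia.
move: E; rewrite eb !(expnM _ 2) ea ec.
have [q1 ->] := expnD_second_order 1 (m ^ 2 * (m ^ 2 - 2)) X.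
have [q2 ->] := expnD_second_order 1 (m ^ 2 * (m ^ 2 + 2)) Z.
rewrite !exp1n !muln1 !(expnMn (m ^ 2)).
move: (_ ^ (2 * Y - 4)) (m ^ 2) m2 => q M M3 E.
have {}E : X * (M - 2) + M * (M - 2) ^ 2 * q1 + M * (16 * q) =
           Z * (M + 2) + M * (M + 2) ^ 2 * q2.
  apply/eqP; rewrite -(@eqn_pmul2l M); last by lia.
  by apply/eqP; move: E; rewrite [M ^ 2]expnS expn1; move: ((M - 2) ^ 2) ((M + 2) ^ 2) (M - 2); lia.
have [k ek] : exists k, M * k + 2 * (X + Z) = M * (X + (M - 2) ^ 2 * q1 + 16 * q).
  by exists (Z + (M + 2) ^ 2 * q2); move: E; move: ((M - 2) ^ 2) ((M + 2) ^ 2); nia.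
by rewrite -(@dvdn_addr (M * k)) ?ek ?dvdn_mulr.
Qed.

(** Once [a^(2Z)] is cancelled, reduction modulo [b^4] leaves [Z a^(2Z-2) b^2 = 0], and [a] is prime
    to [b]. *)
Lemma sqr_leg_leq_exponent a b Y Z : coprime a b -> 0 < b -> 0 < Z -> 1 < Y ->
  a ^ (2 * Z) + b ^ (2 * Y) = (a ^ 2 + b ^ 2) ^ Z -> b ^ 2 <= Z.
Proof.
move=> co b0 Z0 Y1; rewrite !(expnM _ 2).
have [q ->] := expnD_second_order (a ^ 2) (b ^ 2) Z.
rewrite -addnA => /addnI E; apply: dvdn_leq => //.
have b20 : 0 < b ^ 2 by rewrite expn_gt0 b0.
have : b ^ 2 %| Z * (a ^ 2) ^ Z.-1.
  rewrite -(@dvdn_pmul2r (b ^ 2)) // -(@dvdn_addl ((b ^ 2) ^ 2 * q)).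
    by rewrite -E mulnn dvdn_exp2l.
  by rewrite mulnn dvdn_mulr.
by rewrite Gauss_dvdl // coprimeXr // coprimeXr // coprimeXl // coprime_sym.
Qed.

(** The term of index [i] contains [m^(2Z-2i) = m^(Y+K-2i)]. Those with [2i <= K] are multiples of
    [m^Y], and of [n] too unless [i = 0]. The others form [R]: there [n <= m] trades the powers of
    [n] beyond [n^(K+1)] for powers of [m], and the coefficients sum to at most [2^Z]. *)
Lemma expnD_split m n Z K Y : 0 < n <= m -> 2 * Z = Y + K ->
  exists I R, [/\ (m ^ 2 + n ^ 2) ^ Z = m ^ Y * (m ^ K + n * I) + R &
    R * m <= 2 ^ Z * n ^ K.+1 * m ^ Y].
Proof.
move=> /andP[n0 nm] ZK.
have m0 : 0 < m by lia.
pose F (i : 'I_Z.+1) := 'C(Z, i) * (m ^ 2) ^ (Z - i) * (n ^ 2) ^ i.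
have eF : (m ^ 2 + n ^ 2) ^ Z = \sum_(i < Z.+1) F i.
  by rewrite expnDn; apply: eq_bigr => i _; rewrite /F mulnA.
pose G (i : 'I_Z.+1) := 'C(Z, i) * m ^ (K - 2 * i) * n ^ (2 * i).-1.
exists (\sum_(i < Z.+1 | (2 * i <= K) && (0 < i)) G i).
exists (\sum_(i < Z.+1 | ~~ (2 * i <= K)) F i); split.
  rewrite eF (bigID (fun i : 'I_Z.+1 => 2 * i <= K)) /=; congr (_ + _).
  rewrite (bigD1 ord0) //= mulnDr; congr (_ + _).
    by rewrite /F bin0 subn0 expn0 muln1 mul1n -expnM ZK expnD.
  rewrite mulnA big_distrr /=; apply: eq_big => [i|i /andP[iK i0]].
    by rewrite lt0n.
  have {}i0 : 0 < i by rewrite lt0n.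
  rewrite /F /G -!expnM; have -> : 2 * (Z - i) = Y + (K - 2 * i) by lia.
  have -> : n ^ (2 * i) = n * n ^ (2 * i).-1 by rewrite -expnS prednK //; lia.
  by rewrite expnD; lia.
have e2 : 2 ^ Z = \sum_(i < Z.+1) 'C(Z, i).
  by rewrite -[2]/(1 + 1) expnDn; apply: eq_bigr => i _; rewrite !exp1n !muln1.
rewrite big_distrl /= e2 -mulnA big_distrl /=.
rewrite [leqRHS](bigID (fun i : 'I_Z.+1 => 2 * i <= K)) /=.
apply: leq_trans (leq_addl _ _); apply: leq_sum => i; rewrite -ltnNge => iK.
have iZ : i <= Z by rewrite -ltnS.
rewrite /F -!mulnA leq_mul2l; apply/orP; right; rewrite -!expnM.
have -> : m ^ Y = m ^ (2 * i - K.+1) * m ^ (2 * (Z - i)).+1 by rewrite -expnD; congr (_ ^ _); lia.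
have -> : n ^ (2 * i) = n ^ K.+1 * n ^ (2 * i - K.+1) by rewrite -expnD subnKC.
have : n ^ (2 * i - K.+1) <= m ^ (2 * i - K.+1).
  by case: (2 * i - K.+1) => // t; rewrite leq_exp2r.
rewrite [m ^ _.+1]expnS; move: (m ^ (2 * _)) (n ^ K.+1) (m ^ (_ - _)) (n ^ (_ - _)) => A B D C CD.
rewrite (_ : _ * (_ * m) = A * B * m * C); last by lia.
by rewrite (_ : B * _ = A * B * m * D) ?leq_mul2l ?CD ?orbT //; lia.
Qed.

(** As [c = a + 2n^2], doubling suffices: [c^Z <= 2a^Z <= a^(Z+1)]. *)
Lemma leq_expn_hypotenuse m n X Z (a := m ^ 2 - n ^ 2) (c := m ^ 2 + n ^ 2) :
  1 < a -> 4 * Z * n ^ 2 <= a -> Z < X -> c ^ Z <= a ^ X.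
Proof.
move=> a1 h ZX; have nm : n ^ 2 < m ^ 2 by rewrite -subn_gt0 -/a; lia.
have -> : c = a + 2 * n ^ 2 by rewrite /c /a; lia.
apply: leq_trans (@expnD_le_double _ _ _ _ _) _; [lia | lia |].
apply: (@leq_trans (a ^ Z.+1)); first by rewrite expnS leq_mul2r a1 orbT.
by rewrite leq_exp2l.
Qed.

(** * Congruences modulo [m^2] and the case [X < Z] *)

Lemma eqn_modDmull u v p q M : u + M * p = v + M * q -> u = v %[mod M].
Proof. by move=> h; rewrite -(modnMDl p u) -(modnMDl q v) mulnC addnC h mulnC addnC. Qed.

Lemma sqr_subnDmul N M : N <= M -> (M - N) ^ 2 + M * (2 * N) = N ^ 2 + M * M.
Proof. by move=> /subnK <-; rewrite addnK !expnS !expn0; lia. Qed.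

(** Modulo [m^2], [a^2 = n^4], [c = n^2] and [b^(2Y) = 0], so [n^(4X) = n^(4Z)], where [n^(4X)]
    cancels by coprimality. *)
Lemma sqr_dvdn_exp m n X Y Z : n < m -> coprime m n -> X <= Z -> 0 < Y ->
  (m ^ 2 - n ^ 2) ^ (2 * X) + (2 * m * n) ^ (2 * Y) = (m ^ 2 + n ^ 2) ^ (2 * Z) ->
  m ^ 2 %| n ^ (4 * (Z - X)) - 1.
Proof.
move=> nm co XZ Y0 E.
have e4 k : n ^ (4 * k) = ((n ^ 2) ^ 2) ^ k by rewrite -!expnM mulnA.
have bm : m ^ 2 %| (2 * m * n) ^ (2 * Y).
  apply: (@dvdn_trans ((2 * m * n) ^ 2)); last by rewrite dvdn_exp2l // leq_pmulr.
  by rewrite dvdn_exp2r // mulnAC dvdn_mull.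
have cn : (m ^ 2 + n ^ 2) ^ (2 * Z) = n ^ (4 * Z) %[mod m ^ 2].
  by rewrite e4 -expnM -modnXm modnDl modnXm -expnM.
have an : (m ^ 2 - n ^ 2) ^ (2 * X) = n ^ (4 * X) %[mod m ^ 2].
  rewrite e4 (expnM _ 2 X) -modnXm -[RHS]modnXm; congr (_ ^ X %% _).
  apply: (@eqn_modDmull _ _ (2 * n ^ 2) (m ^ 2)).
  by rewrite sqr_subnDmul // leq_sqr ltnW.
have : n ^ (4 * Z) = n ^ (4 * X) %[mod m ^ 2].
  by rewrite -cn -E -modnDmr (eqP bm) addn0.
have [n0|n0] := posnP n.
  move=> _; move: co nm; rewrite n0 /coprime gcdn0 => /eqP-> _; exact: dvd1n.
move/eqP; rewrite eqn_mod_dvd; last by rewrite leq_pexp2l // leq_mul2l.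
rewrite -{1}(subnKC XZ) mulnDr expnD -{2}[n ^ (4 * X)]muln1 -mulnBr.
by rewrite Gauss_dvdr // coprimeXl // coprimeXr.
Qed.

(* After [4^Y <= m^3] is used, [4^K n^(4K+4)] is what remains of
   [(2^Z n^(K+1))^4], where [2Z = Y + K] and [n <= 2^e]. *)
Lemma exponent_bounds e K : K <= 2 * e + 2 ->
  e * K <= 8 * e ^ 2 + 16 * e + 5 /\ 2 * K + e * (K.+1 * 4) < 8 * e ^ 2 + 16 * e + 5.
Proof. by move=> h; rewrite !expnS expn0; nia. Qed.

(* Both sides of [c^Z = b^Y + w] are reduced modulo [m^Y], [K] being [2Z - Y]:
   the binomial terms of [(m^2 + n^2)^Z] divisible by [m^Y] give
   [m^Y (m^K + n I)], while [w] and the remaining terms [R] are both smaller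
   than [m^Y]. Hence [(2n)^Y = m^K + n I], so that [n] divides [m^K]. *)
Lemma no_solution_exponents_lt m n e X Y Z
    (a := m ^ 2 - n ^ 2) (b := 2 * m * n) (c := m ^ 2 + n ^ 2) :
  1 < n < m -> coprime m n -> n <= 2 ^ e -> 2 ^ (8 * e ^ 2 + 16 * e + 5) <= m ->
  0 < X < Z -> 0 < Y -> 4 ^ Y <= m ^ 3 -> 2 ^ Y <= m ^ 2 -> 2 * Z * n ^ 2 <= m ^ 2 ->
  a ^ (2 * X) + b ^ (2 * Y) <> c ^ (2 * Z).
Proof.
move=> /andP[n1 nm] co ne hm /andP[X0 XZ] Y0 h4 h2 hZ E.
have {}hm k : k <= 8 * e ^ 2 + 16 * e + 5 -> 2 ^ k <= m.
  by move=> h; apply: leq_trans hm; rewrite leq_exp2l.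
have n20 : 0 < n ^ 2 by rewrite expn_gt0 ltnW.
have nm2 : n ^ 2 < m ^ 2 by rewrite ltn_sqr.
have a0 : 0 < a by rewrite subn_gt0.
have ac : a < c by rewrite /a /c; lia.
have c0 : 0 < c by lia.
have am : a <= m ^ 2 by rewrite /a; lia.
have mc : m ^ 2 < c by rewrite /c; lia.
have m0 : 0 < m by lia.
have mY0 : 0 < m ^ Y by rewrite expn_gt0 m0.
have bE : b ^ Y = (2 * n) ^ Y * m ^ Y by rewrite -expnMn /b; congr (_ ^ _); lia.
have aX0 : 0 < a ^ (2 * X) by rewrite expn_gt0 a0.
(* Since [X < Z], [a^(2X)] is at most half of [c^(2Z)]; hence [b^(2Y)] exceeds a quarter of it. *)
have lt_cb : c ^ Z < 2 * b ^ Y.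
  have A : 2 * a ^ (2 * X) <= c ^ (2 * Z).
    apply: (@leq_trans (c * c ^ (2 * X))).
      apply: leq_mul; first by lia.
      by rewrite leq_exp2r //; lia.
    by rewrite -expnS leq_exp2l //; lia.
  rewrite -ltn_sqr expnMn -!expnM ![_ * 2]mulnC.
  have : 0 < b ^ (2 * Y) by rewrite expn_gt0 /b !muln_gt0 m0 (ltnW n1).
  by rewrite -[2 ^ 2]/4; lia.
have lt_bc : b ^ Y < c ^ Z.
  by rewrite -ltn_sqr -!expnM ![_ * 2]mulnC -E; lia.
have mZ : m ^ (2 * Z) < c ^ Z by rewrite expnM ltn_exp2r //; lia.
(* Otherwise [c^Z <= 2 m^(2Z) <= 2 m^Y <= (2n)^Y m^Y = b^Y]. *)
have YZ : Y < 2 * Z.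
  rewrite ltnNge; apply/negP => ZY.
  have : c ^ Z <= 2 * m ^ Y.
    apply: leq_trans (@expnD_le_double _ _ _ _ hZ) _; first by lia.
    by rewrite -expnM leq_mul2l leq_exp2l //; lia.
  rewrite leqNgt => /negP; apply; apply: leq_ltn_trans lt_bc.
  rewrite bE leq_mul2r; apply/orP; right.
  by rewrite -[leqLHS]expn1 (@leq_trans (2 ^ Y)) ?leq_exp2l // leq_exp2r //; lia.
pose K := 2 * Z - Y; pose D := Z - X.
have ZK : 2 * Z = Y + K by rewrite /K; lia.
have K0 : 0 < K by rewrite /K; lia.
have lt_mK : m ^ K < 2 * (2 * n) ^ Y.
  rewrite -(@ltn_pmul2l (m ^ Y)) // -expnD -ZK.
  by apply: ltn_trans mZ _; apply: leq_trans lt_cb _; rewrite bE; lia.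
(* With [2n <= 2^(e+1)] and [2^Y <= m^2], the bound [lt_mK] gives [m^K < 2 m^(2e+2) <= m^(2e+3)]. *)
have Ke : K <= 2 * e + 2.
  rewrite -ltnS -(@ltn_exp2l m) //; last by lia.
  apply: leq_trans lt_mK _; rewrite expnS; apply: leq_mul; first by lia.
  rewrite (_ : 2 * e + 2 = 2 * e.+1); last by lia.
  rewrite expnM; apply: (@leq_trans ((2 ^ Y) ^ e.+1)); last by rewrite leq_exp2r.
  by rewrite -expnM [Y * _]mulnC expnM leq_exp2r // expnS leq_mul2l ne.
have le_nX k : n ^ k <= 2 ^ (e * k).
  by rewrite expnM; case: k => // k; rewrite leq_exp2r.
have D4 : m ^ 2 < n ^ (4 * D).
  have d := @sqr_dvdn_exp _ _ _ _ _ nm co (ltnW XZ) Y0 E.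
  have n4 : 1 < n ^ (4 * D) by rewrite -(expn0 n) ltn_exp2l // muln_gt0 subn_gt0.
  have := dvdn_leq (_ : 0 < n ^ (4 * D) - 1) d; rewrite subn_gt0 => /(_ n4).
  by case: (n ^ (4 * D)) n4 => // t _; rewrite subn1.
have [eK1 eK2] := @exponent_bounds _ _ Ke.
(* Powers of [n] are compared: [n^K <= 2^(eK) <= m <= m^2 < n^(4D)]. *)
have KD : K < 4 * D.
  rewrite -(@ltn_exp2l n) //; apply: leq_ltn_trans D4.
  apply: leq_trans (le_nX K) _.
  apply: (@leq_trans m); last by rewrite expnS expn1 leq_pmulr.
  exact: hm.
(* [w (c^Z + b^Y) = a^(2X) <= m^(4X)] and [4X < 2Z + Y]. *)
pose w := c ^ Z - b ^ Y.
have w_lt : w < m ^ Y.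
  rewrite ltnNge; apply/negP => hw.
  have : m ^ (Y + 2 * Z) < m ^ (4 * X).
    apply: (@leq_trans (a ^ (2 * X))).
      have -> : a ^ (2 * X) = w * (c ^ Z + b ^ Y).
        by rewrite /w -subn_sqr -!expnM ![_ * 2]mulnC -E addnK.
      rewrite expnD; apply: (@leq_ltn_trans (w * m ^ (2 * Z))); first by rewrite leq_mul2r hw orbT.
      by rewrite ltn_mul2l subn_gt0 lt_bc (leq_trans mZ (leq_addr _ _)).
    by rewrite (_ : 4 * X = 2 * (2 * X)) ?(expnM m) ?leq_exp2r //; lia.
  by rewrite ltn_exp2l; move: KD; rewrite /D; lia.
have [//|I [R [cE Rm]]] := @expnD_split m n Z K Y _ ZK; first by lia.
have small : 2 ^ Z * n ^ K.+1 < m.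
  rewrite -(@ltn_exp2r _ _ 4) // expnMn -!expnM.
  have -> : 2 ^ (Z * 4) = 4 ^ Y * 4 ^ K.
    by rewrite -!(expnM 2 2) -expnD -mulnDr -ZK mulnA mulnC.
  rewrite [m ^ 4]expnSr -mulnA.
  apply: (@leq_ltn_trans (m ^ 3 * (4 ^ K * n ^ (K.+1 * 4)))); first by rewrite leq_mul2r h4 orbT.
  rewrite ltn_mul2l expn_gt0 m0 /=; apply: leq_trans (hm _ (leqnn _)).
  apply: (@leq_ltn_trans (2 ^ (2 * K) * 2 ^ (e * (K.+1 * 4)))).
    by rewrite -(expnM 2 2) leq_mul2l le_nX orbT.
  by rewrite -expnD ltn_exp2l.
have R_lt : R < m ^ Y.
  rewrite -(@ltn_pmul2r m) //; apply: leq_ltn_trans Rm _.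
  by rewrite mulnC ltn_pmul2l.
have EI : m ^ K + n * I = (2 * n) ^ Y.
  have {}cE : (m ^ K + n * I) * m ^ Y + R = (2 * n) ^ Y * m ^ Y + w.
    by rewrite -bE /w (subnKC (ltnW lt_bc)) /c cE [m ^ Y * _]mulnC.
  have := congr1 (divn^~ (m ^ Y)) cE.
  by rewrite !divnMDl // !divn_small // !addn0.
have : n %| m ^ K.
  rewrite -(@dvdn_addl (n * I)) ?dvdn_mulr // EI.
  by case: (Y) Y0 => // y _; rewrite expnS dvdn_mulr // dvdn_mull.
have : coprime n (m ^ K) by rewrite coprimeXr // coprime_sym.
by rewrite /coprime => /eqP co1 /gcdn_idPl; rewrite co1 => n_eq1; move: n1; rewrite -n_eq1.
Qed.

(** * All cases combined over the natural numbers *)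

Lemma coprime_subn M N : N <= M -> coprime M N -> coprime (M - N) M && coprime (M - N) N.
Proof.
move=> /subnK <-; rewrite addnK /coprime gcdnDl gcdnC gcdnDr gcdnC => ->.
by rewrite andbT.
Qed.

Lemma even_exponents_trivial m n e X Y Z (a := m ^ 2 - n ^ 2) (b := 2 * m * n)
    (c := m ^ 2 + n ^ 2) :
  0 < n < m -> coprime m n -> odd m != odd n -> n <= 2 ^ e -> 0 < e ->
  2 ^ (8 * e ^ 2 + 16 * e + 5) <= m -> 0 < X -> 0 < Y -> 0 < Z ->
  a ^ (2 * X) + b ^ (2 * Y) = c ^ (2 * Z) -> [/\ X = 1, Y = 1 & Z = 1].
Proof.
move=> /andP[n0 nm] co par ne e0 hm X0 Y0 Z0 E.
have m0 : 0 < m := ltn_trans n0 nm.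
have [le_e2 le_7] : e * 2 <= 8 * e ^ 2 + 16 * e + 5 /\ 7 <= 8 * e ^ 2 + 16 * e + 5.
  by clear -e0; lia.
have le_m k : k <= 8 * e ^ 2 + 16 * e + 5 -> 2 ^ k <= m.
  by move=> h; apply: leq_trans hm; rewrite leq_exp2l.
have n2m : n ^ 2 <= m.
  apply: (@leq_trans ((2 ^ e) ^ 2)); first by rewrite leq_sqr.
  by rewrite -expnM; apply: le_m.
have m100 : 100 <= m by apply: (@leq_trans (2 ^ 7)) => //; exact: le_m.
have n20 : 0 < n ^ 2 by rewrite expn_gt0 n0.
have mm : 100 * m <= m ^ 2 by rewrite expnS expn1 leq_mul2r m100 orbT.
have am : 2 * m <= a by rewrite /a; lia.
have a0 : 0 < a by lia.
have ac : a < c by rewrite /a /c; lia.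
have c2a : c <= 2 * a by rewrite /a /c; lia.
have b0 : 0 < b by rewrite /b !muln_gt0 m0 n0.
have abc : a ^ 2 + b ^ 2 = c ^ 2.
  have : n ^ 2 <= m ^ 2 by lia.
  rewrite /a /c (_ : b ^ 2 = 4 * (m ^ 2) * (n ^ 2)); last by rewrite /b !expnMn.
  by move: (m ^ 2) (n ^ 2) => M N /subnK <-; rewrite addnK !expnS !expn0; lia.
have bc : b < c by rewrite -ltn_sqr -abc -[ltnLHS]add0n ltn_add2r expn_gt0 a0.
have oa : odd a by rewrite /a oddB ?oddX ?leq_sqr ?(ltnW nm) //=; move: par; do 2 case: odd.
have b4 : 4 %| b.
  by rewrite /b -mulnA (@dvdn_pmul2l 2 2) // dvdn2 oddM; move: par; do 2 case: odd.
have cab : coprime a b.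
  have nm2 : n ^ 2 <= m ^ 2 by lia.
  have /andP[cm cn] : coprime a m && coprime a n.
    have := @coprime_subn (m ^ 2) (n ^ 2) nm2; rewrite !coprime_pexpr //; apply.
    by rewrite coprime_pexpl.
  by rewrite /b !coprimeMr coprimen2 oa cm cn.
have aXcZ : a ^ X < c ^ Z.
  by rewrite -ltn_sqr -!expnM ![_ * 2]mulnC -E -[ltnLHS]addn0 ltn_add2l expn_gt0 b0.
(* [b^(2Y)] factors as [(c^Z - a^X)(c^Z + a^X)], whose first factor is at least 1. *)
have cZ : c ^ Z < b ^ (2 * Y).
  have := subn_sqr (c ^ Z) (a ^ X); rewrite -!expnM ![_ * 2]mulnC -E addKn => ->.
  have a1 : 0 < a ^ X by rewrite expn_gt0 a0.
  apply: (@leq_trans (c ^ Z + a ^ X)); first by rewrite -addn1 leq_add2l.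
  by rewrite leq_pmull // subn_gt0.
have ZY : Z < 2 * Y.
  rewrite -(@ltn_exp2l c) ?(leq_ltn_trans a0 ac) //; apply: leq_trans cZ _.
  by rewrite leq_exp2r ?(ltnW bc) // muln_gt0.
have a1 : 1 < a by apply: leq_trans am; rewrite (@leq_mul 2 1).
have XZ : X < 2 * Z.
  rewrite -(@ltn_exp2l a) //.
  apply: leq_trans aXcZ _; rewrite expnM leq_exp2r //.
  by apply: leq_trans c2a _; rewrite expnS expn1 leq_mul2r; apply/orP; right; lia.
(* Only [Y = 1] admits the solution [(2, 2, 2)]; the congruences modulo [m^4] and [b^4] need
   [Y >= 2]. *)
have [Y1|Y1] := leqP Y 1.
  have eY : Y = 1 by lia.
  have eZ : Z = 1 by clear -eY ZY Z0; lia.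
  split=> //; move: E; rewrite eY eZ !muln1 -abc => /addIn /eqP.
  by rewrite eqn_exp2l; [lia | lia].
have Y4 : 4 ^ Y <= 4 * Y * m ^ 2.
  have := @pow4_le a b (c ^ Z) X Y X0 oa b4 cab b0.
  rewrite -!expnM ![_ * 2]mulnC => /(_ E) h; apply: leq_trans h _.
  by apply: leq_mul; [clear -XZ ZY; lia | rewrite /a; clear -n20 mm m100; lia].
have [Ym Y2] := pow4_le_polynomial _ _ m100 Y4.
have Y43 : 4 ^ Y <= m ^ 3.
  by apply: leq_trans Y4 _; rewrite [m ^ 3]expnS leq_mul2r; clear -Ym; lia.
have Za : 4 * Z * n ^ 2 <= a.
  rewrite /a leq_subRL; last by lia.
  rewrite -mulSn expnS [m ^ 2]expnS expn1 -expnS.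
  by apply: leq_mul => //; clear -Ym ZY; lia.
have [n1|n1] := leqP n 1.
  have en : n = 1 by lia.
  move: E; rewrite /a /b /c en exp1n muln1 => E.
  have := @sqr_leq_exponents_n1 m X Y Z (leq_trans (isT : 1 < 100) m100) X0 Y1 E.
  by clear -Ym XZ ZY mm; lia.
have [ltXZ|gtXZ|eqXZ] := ltngtP X Z.
- have Zm : 2 * Z * n ^ 2 <= m ^ 2.
    apply: leq_trans (leq_subr (n ^ 2) _); apply: leq_trans Za.
    by rewrite !leq_mul2r !orbT.
  case: (@no_solution_exponents_lt m n e X Y Z _ co ne hm _ Y0 Y43 Y2 Zm E); first by rewrite n1.
  by rewrite X0.
- have := @leq_expn_hypotenuse m n X Z a1 Za gtXZ.
  by rewrite leqNgt aXcZ.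
- move: E; rewrite eqXZ (expnM c) -abc => E.
  have := @sqr_leg_leq_exponent a b Y Z cab b0 Z0 Y1 E.
  have mb : m <= b by rewrite /b mulnAC leq_pmull // muln_gt0.
  have : b <= b ^ 2 by rewrite expnS expn1 leq_pmull.
  by clear -mb ZY Ym m100; lia.
Qed.

(** * From the real size condition to a power of two *)

Local Open Scope R_scope.

Lemma exp_le x y : x <= y -> exp x <= exp y.
Proof. by move=> [h|->]; [apply/Rlt_le/exp_increasing | apply: Rle_refl]. Qed.

Lemma ln_le x y : 0 < x -> x <= y -> ln x <= ln y.
Proof. by move=> x0 [h|->]; [apply/Rlt_le/ln_increasing | apply: Rle_refl]. Qed.

(** Squaring [1 - t <= exp (- t)] seven times, with [t = 0.69 / 128], yields
    [1/2 <= exp (- 0.69)]. *)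
Lemma ln2_ge : 69 / 100 <= ln 2.
Proof.
have dbl r x : 0 <= r -> r <= exp x -> r * r <= exp (x + x).
  by move=> r0 rx; rewrite exp_plus; nra.
have E : 1 - 69 / 12800 <= exp (- (69 / 12800)).
  by have := exp_ineq1_le (- (69 / 12800)); lra.
do 7 (apply dbl in E; last by lra).
set y := _ + _ in E.
have ey : y = - (69 / 100) by rewrite /y; lra.
have h : 1 / 2 <= exp (- (69 / 100)) by rewrite -ey; lra.
have -> : ln 2 = - ln (/ 2) by rewrite ln_Rinv; lra.
suff : ln (/ 2) <= - (69 / 100) by lra.
by rewrite -[X in _ <= X]ln_exp; apply: ln_le; lra.
Qed.

Lemma ln10_ge : 33 / 10 * ln 2 <= ln 10.
Proof.
have h : ln (2 ^ 33) <= ln (10 ^ 10) by apply: ln_le; lra.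
move: h; rewrite !ln_pow; try lra.
rewrite !INR_IZR_INZ /=; lra.
Qed.

Lemma pow2_quadratic_le (m n e : Z) :
  (0 < n)%Z -> (0 <= e)%Z -> (2 ^ e <= n)%Z ->
  IZR m > Rmax (powerRZ 10 109948)
               (Rpower (IZR n) (Rpower (ln (IZR n)) (3 / 2))) ->
  (2 ^ (8 * (e + 1) ^ 2 + 16 * (e + 1) + 5) <= m)%Z.
Proof.
move=> n0 e0 en hm.
set k := (8 * _ + _ + _)%Z.
have k0 : (0 <= k)%Z by rewrite /k; nia.
have m10 : IZR m > powerRZ 10 109948.
  exact: Rle_lt_trans (Rmax_l _ _) hm.
have mn : IZR m > Rpower (IZR n) (Rpower (ln (IZR n)) (3 / 2)).
  exact: Rle_lt_trans (Rmax_r _ _) hm.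
have l2 := ln2_ge; have l10 := ln10_ge.
have pow2 j : (0 <= j)%Z -> IZR (2 ^ j) = exp (IZR j * ln 2).
  move=> j0; rewrite -[exp _]/(Rpower 2 (IZR j)) -powerRZ_Rpower; last by lra.
  by rewrite -{1}(Z2Nat.id j) // -pow_IZR pow_powerRZ Z2Nat.id.
have Ek : IZR k = 8 * (IZR e + 1) ^ 2 + 16 * (IZR e + 1) + 5.
  by rewrite /k Z.pow_2_r !(plus_IZR, mult_IZR); ring.
apply/le_IZR/Rlt_le; rewrite pow2 // Ek.
have e0R : 0 <= IZR e by apply: IZR_le.
have [es|es] := Z_le_gt_dec e 207.
  apply: Rle_lt_trans m10; rewrite powerRZ_Rpower; last by lra.
  have esR : IZR e <= 207 by apply: IZR_le.
  (* 349445 is the value at [e = 207]; it is below [3.3 * 109948]. *)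
  have : 8 * (IZR e + 1) ^ 2 + 16 * (IZR e + 1) + 5 <= 349445 by nra.
  by move=> h; apply: exp_le; nra.
have esR : 208 <= IZR e by apply: IZR_le; lia.
apply: Rle_lt_trans mn; rewrite /Rpower; apply: exp_le.
set L := ln (IZR n).
have LE : IZR e * ln 2 <= L.
  rewrite -[X in X <= _]ln_exp -pow2 //; apply: ln_le; last by apply: IZR_le.
  by apply: IZR_lt; lia.
have L0 : 0 < L by nra.
rewrite -[exp _]/(Rpower L (3 / 2)).
have -> : Rpower L (3 / 2) = L * sqrt L.
  have -> : 3 / 2 = 1 + / 2 by lra.
  by rewrite Rpower_plus Rpower_1 // Rpower_sqrt.
(* [L >= 208 * 0.69 = 143.52], whose root exceeds 11.97. Then [11.97 * 0.69 > 8.25], and the spare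
   [e^2 / 4] covers the linear terms [32e + 29]. *)
have s0 : 1197 / 100 <= sqrt L.
  have -> : 1197 / 100 = sqrt ((1197 / 100) * (1197 / 100)) by rewrite sqrt_square; lra.
  by apply: sqrt_le_1_alt; nra.
have LL : (IZR e * ln 2) * (IZR e * ln 2) <= L * L by apply: Rmult_le_compat; nra.
apply: (Rle_trans _ (1197 / 100 * ((IZR e * ln 2) * (IZR e * ln 2)))); last by nra.
rewrite (_ : 1197 / 100 * _ = (1197 / 100 * ln 2 * IZR e ^ 2) * ln 2); last by ring.
apply: Rmult_le_compat_r; first by lra.
have : 8 * IZR e ^ 2 + 25 / 100 * IZR e ^ 2 <= 1197 / 100 * ln 2 * IZR e ^ 2 by nra.
nra.
Qed.

(* Transfer between integers and natural numbers; conclusion *)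
Local Close Scope R_scope.

Lemma Z_of_nat_expn a k : Z.of_nat (a ^ k)%N = (Z.of_nat a ^ Z.of_nat k)%Z.
Proof. lia. Qed.

Lemma Z_of_nat_mod2 k : (Z.of_nat k mod 2)%Z = Z.of_nat (odd k).
Proof.
rewrite -[in LHS](odd_double_half k) -muln2 Nat2Z.inj_add Nat2Z.inj_mul Z_mod_plus_full.
by case: odd.
Qed.

Lemma Z_of_nat_coprime m n : rel_prime (Z.of_nat m) (Z.of_nat n) -> coprime m n.
Proof.
case=> _ _ H; rewrite /coprime -dvdn1.
have div k : (gcdn m n %| k)%N -> (Z.of_nat (gcdn m n) | Z.of_nat k)%Z.
  by case/dvdnP=> q ->; exists (Z.of_nat q); rewrite Nat2Z.inj_mul.
have /Z.divide_1_r_nonneg e1 := H _ (div _ (dvdn_gcdl m n)) (div _ (dvdn_gcdr m n)).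
by rewrite (_ : gcdn m n = 1%N) //; apply: Nat2Z.inj; exact/e1/Nat2Z.is_nonneg.
Qed.

Lemma even_pos_double x : (0 < x)%Z -> (x mod 2 = 0)%Z ->
  exists2 X : nat, (0 < X)%N & x = Z.of_nat (2 * X).
Proof. by move=> x0 /Z.mod_divide [//|k ek]; exists (Z.to_nat k); lia. Qed.

Theorem theorem1p5 (m n a b c : Z)
  (hn : (0 < n)%Z) (hmn : (n < m)%Z)
  (hcop : rel_prime m n)
  (hpar : (m mod 2 <> n mod 2)%Z)
  (ha : a = (m ^ 2 - n ^ 2)%Z)
  (hb : b = (2 * m * n)%Z)
  (hc : c = (m ^ 2 + n ^ 2)%Z)
  (hm : (IZR m > Rmax (powerRZ 10 109948)
                      (Rpower (IZR n) (Rpower (ln (IZR n)) (3 / 2))))%R) :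
  ~ exists x y z : Z,
      ((0 < x /\ 0 < y /\ 0 < z) /\
       (x, y, z) <> (2, 2, 2) /\
       (x mod 2 = 0 /\ y mod 2 = 0 /\ z mod 2 = 0) /\
       a ^ x + b ^ y = c ^ z)%Z.
Proof.
move=> [x [y [z [[x0 [y0 z0]] [ne [[ex [ey ez]] E]]]]]].
have [X X0 eX] := @even_pos_double x x0 ex.
have [Y Y0 eY] := @even_pos_double y y0 ey.
have [Z Z0 eZ] := @even_pos_double z z0 ez.
have l0 := Z.log2_nonneg n.
have [l1 l2] := Z.log2_spec n hn.
have hme := @pow2_quadratic_le m n _ hn l0 l1 hm.
clear hm; subst x y z a b c.
move: (Z.log2 n) l0 l1 l2 hme => l l0 _ l2 hme.
have [m' em] : exists m', m = Z.of_nat m' by exists (Z.to_nat m); lia.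
have [n' en] : exists n', n = Z.of_nat n' by exists (Z.to_nat n); lia.
have [l' el] : exists l', l = Z.of_nat l' by exists (Z.to_nat l); lia.
subst m n l.
have nm : (n' < m')%N by lia.
have nm2 : (n' ^ 2 <= m' ^ 2)%N by rewrite leq_sqr ltnW.
(* [Z.log2] rounds down, so [n < 2^(l+1)] and the exponent is [l'.+1]. *)
have [||||||||||] := @even_exponents_trivial m' n' l'.+1 X Y Z => //.
- by apply/andP; split => //; lia.
- exact: Z_of_nat_coprime.
- by apply/eqP => o; apply: hpar; rewrite !Z_of_nat_mod2 o.
- apply/leP/Nat2Z.inj_le; rewrite Z_of_nat_expn.
  by move: l2; rewrite -Nat2Z.inj_succ; exact: Z.lt_le_incl.
- apply/leP/Nat2Z.inj_le; rewrite Z_of_nat_expn; apply: Z.le_trans hme.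
  by apply: Z.pow_le_mono_r => //; lia.
- apply: Nat2Z.inj; rewrite Nat2Z.inj_add !Z_of_nat_expn.
  rewrite Nat2Z.inj_sub; last exact/leP.
  have -> : Z.of_nat (2 * m' * n') = (2 * Z.of_nat m' * Z.of_nat n')%Z by clear; lia.
  by rewrite (Nat2Z.inj_add (m' ^ 2)) !Z_of_nat_expn; exact: E.
by move=> X1 Y1 Z1; apply: ne; rewrite X1 Y1 Z1.
Qed.
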